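(* Let $f_1,f_2$ be two non-negative continuous functions with compact support contained in $[0,\infty)$. Assume $\int f_1<\infty$ and $\int f_2<\infty$. Let $\mu_1$ and $\mu_2$ be the measures with density $f_1$ and $f_2$, respectively, with respect to the Lebesgue measure. If there exists $x_0>0$ such that $f_1(x_0)<f_2(x_0)$ and such that $f_1(x)\le f_2(x)$ for all $x\ge x_0$, then $\mu_1\preceq\mu_2$.
   Context: $f_1,f_2$ are functions on $\mathbb{R}$. $\mathbb{N}$ is the set of natural numbers including $0$. For a finite positive Borel measure $\mu$ on $[0,\infty)$ all of whose moments $s_n(\mu)=\int_0^\infty t^n\,d\mu(t)$, $n\in\mathbb{N}$, exist, the tail relation is defined by: $\mu_1\preceq\mu_2$ if and only if there is $n_0\in\mathbb{N}$ such that $s_n(\mu_1)\le s_n(\mu_2)$ for all $n\ge n_0$. *)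

(* Defs.v *)
From HB Require Import structures.
From mathcomp Require Import all_boot all_order all_algebra.
From mathcomp Require Import all_classical all_reals all_analysis.

Set Implicit Arguments.
Unset Strict Implicit.
Unset Printing Implicit Defensive.

Import Order.TTheory GRing.Theory Num.Theory.
Import numFieldNormedType.Exports.

Local Open Scope classical_set_scope.
Local Open Scope ring_scope.

Definition tsupport (R : realType) (f : R -> R) : set R :=
  closure [set x | f x != 0].

Definition has_density (R : realType)
    (mu : {measure set (measurableTypeR R) -> \bar R}) (f : R -> R) : Prop :=
  forall A : set (measurableTypeR R), measurable A ->
    mu A = (\int[lebesgue_measure]_(x in A) (f x)%:E)%E.

Definition moment (R : realType)
    (mu : {measure set (measurableTypeR R) -> \bar R}) (n : nat) : \bar R :=
  (\int[mu]_(t in `[0%R, +oo[) (t ^+ n)%:E)%E.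

(* A Borel measure on [0, +oo[ is encoded as a Borel measure on the real line
   that gives mass 0 to the negative half-line. *)
Definition has_finite_moments (R : realType)
    (mu : {measure set (measurableTypeR R) -> \bar R}) : Prop :=
  [/\ fin_num_fun mu,
      mu `]-oo, 0%R[%classic = 0%E
    & forall n : nat, mu.-integrable `[0%R, +oo[ (fun t : R => (t ^+ n)%:E)].

(* The relation only relates measures that lie in its domain, hence the two
   membership clauses; by them all the moments compared are real numbers. *)
Definition tail_le (R : realType)
    (mu1 mu2 : {measure set (measurableTypeR R) -> \bar R}) : Prop :=
  [/\ has_finite_moments mu1, has_finite_moments mu2
    & exists n0 : nat, forall n : nat, (n0 <= n)%N ->
        (moment mu1 n <= moment mu2 n)%E].

(* Main.v *)
Require Import Defs.
From HB Require Import structures.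
From mathcomp Require Import all_boot all_order all_algebra.
From mathcomp Require Import all_classical all_reals all_analysis.
From mathcomp Require Import measurable_realfun lra.
Import Order.TTheory GRing.Theory Num.Theory.
Import numFieldNormedType.Exports.
Local Open Scope classical_set_scope.
Local Open Scope ring_scope.

(** High moments are governed by what happens far to the right.  Below [x0]
    the density [f1] may exceed [f2], but there [x ^+ n <= x0 ^+ n], so this
    excess contributes at most [x0 ^+ n] times the integral of [f1].  By
    continuity [f2 - f1] stays at least some [c > 0] on an interval [[a, b]] lying
    strictly to the right of [x0] ([continuous_gap_right]), so beyond [x0] the
    measure with density [f2] gains at least [a ^+ n * (c * (b - a))].  As
    [x0 < a], this gain beats the loss for all large [n] ([expr_dominates]).
    Both estimates follow by integrating one pointwise inequality, which avoids
    subtracting integrals ([integral_pow_eventually_le]).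

    Moments are integrals against [mu1] and [mu2]; the change of variables
    [ge0_integral_density] turns them into Lebesgue integrals of
    [x ^+ n * f x].  They are finite because a compact support bounds [x ^+ n]
    where the density does not vanish ([has_finite_moments_density]). *)

(** A Radon-Nikodym derivative satisfies this identity, and it agrees almost
    everywhere with any density [p], since both have the same integral over
    every measurable set. *)
Lemma ge0_integral_density d (T : measurableType d) (R : realType)
    (la : {sigma_finite_measure set T -> \bar R})
    (nu : {measure set T -> \bar R}) (p : T -> \bar R) :
  la.-integrable setT p -> (forall x, 0 <= p x)%E ->
  (forall A, measurable A -> nu A = \int[la]_(x in A) p x)%E ->
  forall (E : set T) (g : T -> \bar R), measurable E -> measurable_fun E g ->
  (forall x, E x -> 0 <= g x)%E ->
  (\int[nu]_(x in E) g x = \int[la]_(x in E) (g x * p x))%E.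
Proof.
move=> ip p0 nup E g mE mg g0.
have nuT : (nu setT < +oo)%E.
  rewrite nup//; case/integrableP: ip => _; apply: le_lt_trans.
  rewrite le_eqVlt; apply/orP; left; apply/eqP/eq_integral => x _.
  by rewrite gee0_abs.
(* Restricting nu to the whole space leaves its values unchanged and gives it
   the structure of a finite measure. *)
pose fnu := mfrestr measurableT nuT.
have fnuE A : fnu A = nu A by rewrite /fnu /= /mfrestr /mrestr setIT.
have fnula : fnu `<< la.
  apply/null_content_dominatesP => A mA A0; rewrite fnuE nup//.
  by apply: null_set_integral => //; exact: measurable_funTS (measurable_int _ ip).
have gE x : x \in E -> g x = `|g x|%E.
  by move=> /[!inE] /g0 gx0; rewrite gee0_abs.
rewrite (@eq_measure_integral _ _ _ _ fnu); last first.
  by move=> A _ _; exact/esym/fnuE.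
rewrite (eq_integral _ _ gE).
rewrite -(Radon_Nikodym_SigmaFinite.change_of_variables fnula)//; last first.
  exact: measurableT_comp.
under eq_integral => x xE do rewrite -gE//.
have idens := Radon_Nikodym_SigmaFinite.f_integrable fnula.
apply: ae_eq_integral => //.
- apply: emeasurable_funM => //.
  exact: measurable_funTS (measurable_int _ idens).
- by apply: emeasurable_funM => //; exact: measurable_funTS (measurable_int _ ip).
- apply: ae_eqe_mul2l; apply: integral_ae_eq => //.
  + exact: integrableS idens.
  + exact: measurable_funTS (measurable_int _ ip).
  + move=> A _ mA.
    rewrite -Radon_Nikodym_SigmaFinite.f_integral// -nup//; exact: fnuE.
Qed.

Lemma moment_density (R : realType) (f : R -> R)
    (mu : {measure set (measurableTypeR R) -> \bar R}) (n : nat) :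
  measurable_fun setT f -> (forall x, 0 <= f x) ->
  (\int[lebesgue_measure]_x (f x)%:E < +oo)%E -> has_density mu f ->
  moment mu n = (\int[lebesgue_measure]_(x in `[0%R, +oo[) (x ^+ n * f x)%:E)%E.
Proof.
move=> mf f0 fi fd; rewrite /moment.
rewrite (@ge0_integral_density _ _ _ (@lebesgue_measure R) mu (EFin \o f))//.
- apply/integrableP; split; first exact/measurable_EFinP.
  by under eq_integral do rewrite /= ger0_norm//.
- by apply: measurable_funTS; apply/measurable_EFinP; exact: exprn_measurable.
- by move=> x /=; rewrite in_itv/= andbT lee_fin => x0; exact: exprn_ge0.
Qed.

Lemma has_finite_moments_density (R : realType) (f : R -> R)
    (mu : {measure set (measurableTypeR R) -> \bar R}) (M : R) :
  measurable_fun setT f -> (forall x, 0 <= f x) ->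
  (\int[lebesgue_measure]_x (f x)%:E < +oo)%E -> has_density mu f ->
  (forall x, f x != 0 -> 0 <= x <= M) -> has_finite_moments mu.
Proof.
move=> mf f0 fi fd fM; split.
- move=> A mA; rewrite ge0_fin_numE// fd//; apply: le_lt_trans fi.
  apply: ge0_subset_integral => //=; first exact/measurable_EFinP.
  by move=> x _; rewrite lee_fin.
- rewrite fd//; apply: integral0_eq => x /=; rewrite in_itv/= => x0.
  by have [->//|/fM] := eqVneq (f x) 0; rewrite leNgt x0.
have mX n : measurable_fun (`[0%R, +oo[ : set R) (fun x : R => x ^+ n).
  exact: measurable_funTS.
move=> n; apply/integrableP; split; first exact/measurable_EFinP.
rewrite [X in (X < _)%E](_ : _ = moment mu n); last first.
  apply: eq_integral => x /[!inE]/=; rewrite in_itv/= andbT => x0.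
  by rewrite ger0_norm// exprn_ge0.
rewrite (moment_density _ _ _ n mf f0 fi fd).
have mfD : measurable_fun (`[0%R, +oo[ : set R) f by exact: measurable_funTS.
(* The absolute value keeps the bound nonnegative when M < 0, that is, when
   f is zero. *)
have iM : (\int[lebesgue_measure]_(x in `[0%R, +oo[)
    ((`|M| ^+ n)%:E * (f x)%:E) < +oo)%E.
  rewrite ge0_integralZl_EFin//; last 2 first.
  - by move=> x _; rewrite lee_fin.
  - exact/measurable_EFinP.
  rewrite lte_mul_pinfty ?lee_fin ?exprn_ge0//.
  rewrite (le_lt_trans _ fi)//; apply: ge0_subset_integral => //.
    exact/measurable_EFinP.
  by move=> x _; rewrite lee_fin.
apply: le_lt_trans iM; apply: ge0_le_integral => //=.
- by move=> x; rewrite in_itv/= andbT => x0; rewrite lee_fin mulr_ge0// exprn_ge0.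
- by apply/measurable_EFinP; exact: measurable_funM.
- by apply/measurable_EFinP; exact: measurable_funM.
- move=> x; rewrite in_itv/= andbT => x0; rewrite lee_fin.
  have [->|/fM /andP[_ xM]] := eqVneq (f x) 0; first by rewrite !mulr0.
  by rewrite ler_wpM2r// lerXn2r// ?nnegrE// (le_trans xM)// ler_norm.
Qed.

(** The interval starts strictly after [x0], which is what later makes
    [a ^+ n] outgrow [x0 ^+ n]. *)
Lemma continuous_gap_right (R : realType) (f1 f2 : R -> R) (x0 : R) :
  continuous f1 -> continuous f2 -> f1 x0 < f2 x0 ->
  exists a b c, [/\ x0 < a, a < b, 0 < c
    & forall x, a <= x <= b -> f1 x + c <= f2 x].
Proof.
move=> cf1 cf2 f12.
have cg : f2 x - f1 x @[x --> x0] --> f2 x0 - f1 x0.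
  by apply: cvgB; [exact: cf2|exact: cf1].
have c0 : 0 < (f2 x0 - f1 x0) / 2 by rewrite divr_gt0// subr_gt0.
have half_lt : (f2 x0 - f1 x0) / 2 < f2 x0 - f1 x0 by lra.
have : \forall x \near x0, (f2 x0 - f1 x0) / 2 < f2 x - f1 x.
  exact: cvgr_gt cg _ half_lt.
move=> /nbhs_ballP[e /= e0 eg].
exists (x0 + e / 3), (x0 + e / 2), ((f2 x0 - f1 x0) / 2); split => //.
- by rewrite ltrDl divr_gt0.
- lra.
- move=> x /andP[ax xb]; rewrite addrC -lerBrDr ltW//; apply: eg.
  by rewrite /ball/= ltr_norml; lra.
Qed.

Lemma expr_dominates (R : realType) (x0 a A B : R) :
  0 < x0 -> x0 < a -> 0 < B ->
  exists n0 : nat, forall n, (n0 <= n)%N -> x0 ^+ n * A <= a ^+ n * B.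
Proof.
move=> x00 x0a B0.
have a0 : 0 < a by exact: lt_trans x0a.
have q1 : `|x0 / a| < 1.
  by rewrite ger0_norm ?divr_ge0 ?ltW// ltr_pdivrMr// mul1r.
have [n0 _ n0P] := cvgr_lt _ (cvg_geometric A q1) _ B0.
exists n0 => n /n0P; rewrite /geometric/= expr_div_n mulrA ltr_pdivrMr ?exprn_gt0//.
by move=> h; rewrite mulrC [leRHS]mulrC ltW.
Qed.

(** For [x >= 0], the inequality
    [x ^+ n * f1 x + a ^+ n * c * \1_`[a, b] x <= x ^+ n * f2 x + x0 ^+ n * f1 x]
    holds on each side of [x0] for a different reason: to the left the last
    term pays for everything, to the right [f1 <= f2] suffices outside [[a, b]]
    and the gap [c] suffices inside.  After integration the two extra terms are
    compared by [expr_dominates]. *)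
Lemma integral_pow_eventually_le (R : realType) (f1 f2 : R -> R) (x0 a b c : R) :
  measurable_fun setT f1 -> measurable_fun setT f2 ->
  (forall x, 0 <= f1 x) -> (forall x, 0 <= f2 x) ->
  (\int[lebesgue_measure]_x (f1 x)%:E < +oo)%E ->
  0 < x0 -> x0 < a -> a < b -> 0 < c ->
  (forall x, x0 <= x -> f1 x <= f2 x) ->
  (forall x, a <= x <= b -> f1 x + c <= f2 x) ->
  exists n0 : nat, forall n, (n0 <= n)%N ->
    (\int[lebesgue_measure]_(x in `[0%R, +oo[) (x ^+ n * f1 x)%:E <=
     \int[lebesgue_measure]_(x in `[0%R, +oo[) (x ^+ n * f2 x)%:E)%E.
Proof.
move=> mf1 mf2 f10 f20 f1i x00 x0a ab c0 f12 gap.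
have a0 : 0 <= a by rewrite ltW// (lt_trans x00).
pose C := fine (\int[lebesgue_measure]_x (f1 x)%:E)%E.
have C_E : (\int[lebesgue_measure]_x (f1 x)%:E)%E = C%:E.
  by rewrite fineK// ge0_fin_numE// integral_ge0// => x _; rewrite lee_fin.
have cba : 0 < c * (b - a) by rewrite mulr_gt0// subr_gt0.
have [n0 n0P] := expr_dominates _ _ _ C _ x00 x0a cba.
exists n0 => n /n0P dom.
have key (x : R) : 0 <= x ->
    x ^+ n * f1 x + a ^+ n * c * \1_`[a, b] x <= x ^+ n * f2 x + x0 ^+ n * f1 x.
  move=> xge0; have [xx0|x0x] := ltP x x0.
    rewrite indicE memNset ?mulr0 ?addr0; last first.
      rewrite /= in_itv/= => /andP[ax _].
      by move: (lt_trans xx0 x0a); rewrite ltNge ax.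
    apply: ler_wpDl; first by rewrite mulr_ge0 ?exprn_ge0.
    by rewrite ler_wpM2r// lerXn2r// ?nnegrE ltW.
  apply: ler_wpDr; first by rewrite mulr_ge0 ?exprn_ge0// ltW.
  rewrite indicE; case: (boolP (x \in _)) => [|_]; last first.
    by rewrite mulr0 addr0 ler_wpM2l ?exprn_ge0// f12.
  rewrite inE/= in_itv/= => /andP[ax xb].
  rewrite mulr1 (@le_trans _ _ (x ^+ n * (f1 x + c)))//.
    by rewrite mulrDr lerD2l ler_wpM2r ?(ltW c0)// lerXn2r.
  by rewrite ler_wpM2l ?exprn_ge0// gap// ax.
have mX (f : R -> R) : measurable_fun setT f ->
    measurable_fun (`[0%R, +oo[ : set R) (fun x : R => (x ^+ n * f x)%:E).
  move=> mf; apply/measurable_EFinP; apply: measurable_funTS.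
  exact: measurable_funM.
have mZ (k : R) (f : R -> R) : measurable_fun setT f ->
    measurable_fun (`[0%R, +oo[ : set R) (fun x : R => (k * f x)%:E).
  move=> mf; apply/measurable_EFinP; apply: measurable_funTS.
  exact: measurable_funM.
have pX (f : R -> R) (x : R) : (forall x, 0 <= f x) -> 0 <= x ->
    (0 <= (x ^+ n * f x)%:E)%E.
  by move=> f0 xge0; rewrite lee_fin mulr_ge0 ?exprn_ge0.
have anc0 : 0 <= a ^+ n * c by rewrite mulr_ge0 ?exprn_ge0// ltW.
have x0n0 : 0 <= x0 ^+ n by rewrite exprn_ge0// ltW.
have bump : (\int[lebesgue_measure]_(x in `[0%R, +oo[)
    (a ^+ n * c * \1_`[a, b] x)%:E = (a ^+ n * (c * (b - a)))%:E)%E.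
  under eq_integral do rewrite EFinM.
  rewrite ge0_integralZl_EFin//; last first.
    by apply/measurable_EFinP; exact: measurable_funTS.
  rewrite integral_indic// setIidl; last first.
    by move=> x /=; rewrite !in_itv/= andbT => /andP[/(le_trans a0)].
  by rewrite /= lebesgue_measure_itv/= lte_fin ab -EFinD -EFinM mulrA.
have low : (\int[lebesgue_measure]_(x in `[0%R, +oo[) (x0 ^+ n * f1 x)%:E
    <= (x0 ^+ n * C)%:E)%E.
  under eq_integral do rewrite EFinM.
  rewrite ge0_integralZl_EFin//; last 2 first.
  - by move=> x _; rewrite lee_fin.
  - by apply/measurable_EFinP; exact: measurable_funTS.
  rewrite EFinM -C_E; apply: lee_wpmul2l; first by rewrite lee_fin.
  apply: ge0_subset_integral => //; first exact/measurable_EFinP.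
  by move=> x _; rewrite lee_fin.
have : (\int[lebesgue_measure]_(x in `[0%R, +oo[)
          ((x ^+ n * f1 x)%:E + (a ^+ n * c * \1_`[a, b] x)%:E)
     <= \int[lebesgue_measure]_(x in `[0%R, +oo[)
          ((x ^+ n * f2 x)%:E + (x0 ^+ n * f1 x)%:E))%E.
  apply: ge0_le_integral => //.
  - move=> x; rewrite /= in_itv/= andbT => xge0.
    by rewrite adde_ge0 ?pX// lee_fin mulr_ge0.
  - by apply: emeasurable_funD; [exact: mX|exact: mZ].
  - by apply: emeasurable_funD; [exact: mX|exact: mZ].
  - by move=> x; rewrite /= in_itv/= andbT => xge0; rewrite -!EFinD lee_fin key.
rewrite !ge0_integralD//; first last.
- exact: mZ.
- by move=> x _; rewrite lee_fin mulr_ge0.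
- exact: mX.
- by move=> x; rewrite /= in_itv/= andbT; exact: pX.
- exact: mZ.
- by move=> x _; rewrite lee_fin mulr_ge0.
- exact: mX.
- by move=> x; rewrite /= in_itv/= andbT; exact: pX.
rewrite bump => sum_le.
set y := (a ^+ n * (c * (b - a)))%:E in sum_le.
set I1 := (X in (X <= _)%E); set I2 := (X in (_ <= X)%E).
suff : (I1 + y <= I2 + y)%E by rewrite leeD2rE.
apply: (le_trans sum_le); rewrite leeD2l//.
by apply: (le_trans low); rewrite lee_fin.
Qed.

Theorem proposition9 (R : realType) (f1 f2 : R -> R)
    (f1_ge0 : forall x : R, 0 <= f1 x) (f2_ge0 : forall x : R, 0 <= f2 x)
    (f1_cont : continuous f1) (f2_cont : continuous f2)
    (f1_compact : compact (tsupport f1)) (f2_compact : compact (tsupport f2))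
    (f1_supp : tsupport f1 `<=` `[0, +oo[) (f2_supp : tsupport f2 `<=` `[0, +oo[)
    (f1_int : (\int[lebesgue_measure]_x (f1 x)%:E < +oo)%E)
    (f2_int : (\int[lebesgue_measure]_x (f2 x)%:E < +oo)%E)
    (mu1 mu2 : {measure set (measurableTypeR R) -> \bar R})
    (mu1_dens : has_density mu1 f1) (mu2_dens : has_density mu2 f2) :
  (exists x0 : R, [/\ 0 < x0, f1 x0 < f2 x0
      & forall x : R, x0 <= x -> f1 x <= f2 x]) ->
  tail_le mu1 mu2.
Proof.
move=> [x0 [x0_gt0 f12x0 f12]].
have mf1 := continuous_measurable_fun f1_cont.
have mf2 := continuous_measurable_fun f2_cont.
have suppP f : compact (tsupport f) -> tsupport f `<=` `[0, +oo[ ->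
    exists M : R, forall x, f x != 0 -> 0 <= x <= M.
  move=> fK f_supp; have [M [_ MP]] := compact_bounded fK.
  exists (M + 1) => x fx; have sx : tsupport f x by exact: subset_closure.
  have := f_supp _ sx; rewrite /= in_itv/= andbT => -> /=.
  by apply: le_trans (ler_norm _) _; apply: MP sx; rewrite ltrDl.
have [M1 M1P] := suppP _ f1_compact f1_supp.
have [M2 M2P] := suppP _ f2_compact f2_supp.
split; [exact: has_finite_moments_density M1P|exact: has_finite_moments_density M2P|].
have [a [b [c [x0a ab c0 gap]]]] := continuous_gap_right _ _ _ _ f1_cont f2_cont f12x0.
have [n0 n0P] := integral_pow_eventually_le _ _ _ _ _ _ _ mf1 mf2 f1_ge0 f2_ge0
  f1_int x0_gt0 x0a ab c0 f12 gap.
exists n0 => n /n0P.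
by rewrite (moment_density _ f1)// (moment_density _ f2).
Qed.
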